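(* Let $f\in L^1(\mathbb{R})$ and let $\psi$ be measurable with $\psi f\in L^1(\mathbb{R})$. Fix $\rho\in\mathcal{S}(\mathbb{R})$ with $0\le\rho\le1$ and $\rho(0)=1$ (for instance $\rho(x)=e^{-x^2/2}$), and set $\varphi_\varepsilon(x):=\rho(\varepsilon x)$ for $\varepsilon>0$. Then $\varphi_\varepsilon\in\mathcal{S}(\mathbb{R})$, $\varphi_\varepsilon>0$, $\varphi_\varepsilon\to1$ pointwise as $\varepsilon\downarrow0$, and $$\mathbb{E}_{T_f,\varphi_\varepsilon}[\psi]=\int_{\mathbb{R}}\psi(x)\varphi_\varepsilon(x)f(x)\,dx\;\longrightarrow\;\int_{\mathbb{R}}\psi(x)f(x)\,dx\qquad(\varepsilon\downarrow0).$$ In particular, $\psi(x)=x^n$ recovers the ordinary $n$-th moment $\int x^n f(x)\,dx$ whenever it exists, and $\psi(x)=e^{itx}$ recovers the classical characteristic function $\int e^{itx}f(x)\,dx$ for every $t\in\mathbb{R}$.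
   Context: $\mathcal{S}(\mathbb{R})$ is the Schwartz space of rapidly decreasing smooth functions. For $f\in L^1(\mathbb{R})$, $T_f$ is the tempered distribution induced by $f$, and the weak expectation of $\psi$ for the pair $(T_f,\varphi)$ with $\varphi\in\mathcal{S}(\mathbb{R})$ is $\mathbb{E}_{T_f,\varphi}[\psi]=\int_{\mathbb{R}} f(x)\psi(x)\varphi(x)\,dx$.
   Formalization: The claim φ_ε>0 fails for a compactly supported bump ρ with 0≤ρ≤1 and ρ(0)=1; it is replaced by φ_ε≥0 in general and φ_ε>0 whenever ρ>0 everywhere (as for the Gaussian). *)

(* Defs.v *)
From HB Require Import structures.
From mathcomp Require Import all_boot all_order all_algebra.
From mathcomp Require Import complex.
From mathcomp Require Import all_classical all_reals all_analysis.

Set Implicit Arguments.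
Unset Strict Implicit.
Unset Printing Implicit Defensive.
Import Order.TTheory GRing.Theory Num.Theory.
Import numFieldNormedType.Exports.
Local Open Scope classical_set_scope.
Local Open Scope ring_scope.
Local Open Scope complex_scope.

Definition schwartz (R : realType) (g : R -> R) : Prop :=
  (forall (n : nat) (x : R), derivable (derive1n n g) x 1) /\
  (forall k n : nat, exists C : R, forall x : R,
     `|x ^+ k * derive1n n g x| <= C).

(* [Re] and [Im] are the components of [R[i]], not the endomorphisms 'Re and
   'Im of a numClosedFieldType. *)
Definition re_part (R : realType) (g : R -> R[i]) (x : R) : R :=
  complex.Re (g x).
Definition im_part (R : realType) (g : R -> R[i]) (x : R) : R :=
  complex.Im (g x).

(* The domain is the line with its Lebesgue (Caratheodory) sigma-algebra, on
   which [completed_lebesgue_measure] lives; the codomain is Borel. *)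
Definition measurable_cfun (R : realType) (g : R -> R[i]) : Prop :=
  measurable_fun [set: caratheodory_type (wlength (@idfun R))^*%mu]
    (re_part g) /\
  measurable_fun [set: caratheodory_type (wlength (@idfun R))^*%mu]
    (im_part g).

(* [integrable] includes measurability, so this is membership in L^1(R; C) for
   an everywhere defined representative. *)
Definition integrable_cfun (R : realType) (g : R -> R[i]) : Prop :=
  (@completed_lebesgue_measure R).-integrable setT (EFin \o re_part g) /\
  (@completed_lebesgue_measure R).-integrable setT (EFin \o im_part g).

Definition cintegral (R : realType) (g : R -> R[i]) : R[i] :=
  (\int[@completed_lebesgue_measure R]_x re_part g x) +i*
  (\int[@completed_lebesgue_measure R]_x im_part g x).

Definition weak_expectation (R : realType) (f : R -> R[i]) (phi : R -> R)
    (psi : R -> R[i]) : R[i] :=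
  cintegral (fun x => f x * psi x * (phi x)%:C).

Definition dilate (R : realType) (rho : R -> R) (eps : R) : R -> R :=
  fun x => rho (eps * x).

Definition cmonomial (R : realType) (n : nat) (x : R) : R[i] := (x ^+ n)%:C.

(* x |-> exp(itx), by Euler's formula *)
Definition cexp_char (R : realType) (t : R) (x : R) : R[i] :=
  cos (t * x) +i* sin (t * x).

Definition gaussian (R : realType) (x : R) : R := expR (- x ^+ 2 / 2).

(* Main.v *)
(* Since 0 <= rho <= 1, the integrand psi(x) f(x) rho(eps x) is dominated by
   psi * f, and it tends to psi * f pointwise because rho is continuous with
   rho 0 = 1; dominated convergence along every sequence eps_n > 0 tending to 0,
   applied to the real and imaginary parts separately, gives the limit.  The
   derivatives of the Gaussian are polynomial multiples of it, so its Schwartz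
   bounds reduce to those of x ^ k * exp (- x^2 / 2). *)

Require Import Defs.
From HB Require Import structures.
From mathcomp Require Import all_boot all_order all_algebra.
From mathcomp Require Import complex.
From mathcomp Require Import all_classical all_reals all_analysis.
From mathcomp Require Import measurable_realfun ring lra zify.

Import Order.TTheory GRing.Theory Num.Theory.
Import numFieldNormedType.Exports.
Local Open Scope classical_set_scope.
Local Open Scope ring_scope.
Local Open Scope complex_scope.

(** * Dilates of Schwartz functions *)

Lemma derivable_is_derive1 (R : realType) (g : R -> R) (x : R) :
  derivable g x 1 -> is_derive x 1 g (derive1 g x).
Proof. by move=> dg; rewrite derive1E; exact: derivableP. Qed.

Lemma is_derive_dilate (R : realType) (g : R -> R) (e x : R) :
  derivable g (e * x) 1 ->
  is_derive x 1 (dilate g e) (e * derive1 g (e * x)).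
Proof.
move=> /derivable_is_derive1 dg; rewrite mulrC.
apply: is_derive1_comp.
have -> : ( *%R e) = e *: (@idfun R) by [].
apply: is_derive_eq; exact: mulr1.
Qed.

Lemma derive1n_dilate (R : realType) (g : R -> R) (e : R) (n : nat) :
  (forall (m : nat) (x : R), derivable (derive1n m g) x 1) ->
  derive1n n (dilate g e) = fun x => e ^+ n * dilate (derive1n n g) e x.
Proof.
move=> dg; elim: n => [|n IHn].
  by apply/funext => x; rewrite expr0 mul1r.
apply/funext => x; rewrite derive1nS IHn derive1E.
have dn := is_derive_dilate _ _ _ _ (dg n (e * x)).
(* Refolding the pointwise product as a scaled function lets instance resolution compute the
   derivative from [dn]. *)
rewrite -[X in 'D_1 X x]/(e ^+ n *: dilate (derive1n n g) e).
by rewrite derive_val -derive1nS exprSr -mulrA.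
Qed.

Lemma schwartz_dilate (R : realType) (g : R -> R) (e : R) :
  0 < e -> schwartz g -> schwartz (dilate g e).
Proof.
move=> e0 [dg bg]; split=> [n x|k n].
  rewrite derive1n_dilate //.
  rewrite -[X in derivable X x 1]/(e ^+ n *: dilate (derive1n n g) e).
  have dn := is_derive_dilate _ _ _ _ (dg n (e * x)).
  exact: ex_derive.
have [C hC] := bg k n.
(* Substituting y = e x costs [e ^- k] from the monomial and [e ^+ n] from the chain rule. *)
exists (`|e ^- k * e ^+ n| * C) => x.
rewrite derive1n_dilate // /dilate.
have -> : x ^+ k * (e ^+ n * derive1n n g (e * x)) =
    (e ^- k * e ^+ n) * ((e * x) ^+ k * derive1n n g (e * x)).
  have ek : e ^+ k != 0 by rewrite expf_neq0 // gt_eqF.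
  by rewrite exprMn; field.
by rewrite normrM ler_wpM2l.
Qed.

(** * The Gaussian is a Schwartz function *)

Lemma is_derive_gaussian (R : realType) (x : R) :
  is_derive x 1 (@gaussian R) (- x * gaussian x).
Proof.
rewrite mulrC.
apply: (@is_derive1_comp R expR (fun y => - y ^+ 2 / 2) x).
have -> : (fun y : R => - y ^+ 2 / 2) = (- 2^-1) *: (@idfun R ^+ 2).
  by apply/funext => y /=; rewrite mulNr -mulrN mulrC.
apply: is_derive_eq => /=; rewrite /GRing.scale /=; by field.
Qed.

(** Up to sign these are the Hermite polynomials; mere existence suffices, since the Gaussian beats
    every polynomial factor. *)
Lemma derive1n_gaussian (R : realType) (n : nat) :
  exists p : {poly R}, derive1n n (@gaussian R) = fun x => p.[x] * gaussian x.
Proof.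
elim: n => [|n [p IHn]].
  by exists 1; apply/funext => x; rewrite hornerC mul1r.
(* This is the product rule, the Gaussian contributing the factor -x. *)
exists (p^`() - 'X * p); apply/funext => x.
rewrite derive1nS IHn derive1E.
have dgx := is_derive_gaussian _ x.
rewrite -[X in 'D_1 X x]/(horner p * @gaussian R).
rewrite derive_val !hornerE /GRing.scale /=; ring.
Qed.

(** After division by the Gaussian the claim reads |x|^k <= C exp(x^2/2). The term of order k+1 of
    the exponential series at x^2/2 dominates |x|^k when |x| >= 1; the summand 1 of the constant
    covers |x| <= 1. *)
Lemma gaussian_monomial_bounded (R : realType) (k : nat) :
  exists C : R, forall x : R, `|x ^+ k * gaussian x| <= C.
Proof.
exists (1 + 2 ^+ k.+1 * k.+1`!%:R) => x.
have g0 : 0 < gaussian x by exact: expR_gt0.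
rewrite normrM (gtr0_norm g0) -ler_pdivlMr // /gaussian mulNr -expRN opprK.
have y0 : 0 <= x ^+ 2 / 2 by rewrite divr_ge0 // sqr_ge0.
have := expR_ge1Dxn k y0.
set E := expR _ => hE.
have fk : 0 < k.+1`!%:R :> R by rewrite ltr0n fact_gt0.
have xE : `|x| ^+ (2 * k.+1) <= 2 ^+ k.+1 * k.+1`!%:R * E.
  have -> : `|x| ^+ (2 * k.+1) =
      2 ^+ k.+1 * k.+1`!%:R * ((x ^+ 2 / 2) ^+ k.+1 / k.+1`!%:R).
    rewrite exprM real_normK ?num_real // expr_div_n; field.
    by rewrite (gt_eqF fk) expf_neq0.
  rewrite ler_pM2l ?mulr_gt0 ?exprn_gt0 //.
  by apply: le_trans hE; rewrite lerDr.
have E1 : 1 <= E.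
  by apply: le_trans hE; rewrite lerDl divr_ge0 ?exprn_ge0 // ltW.
rewrite mulrDl mul1r normrX.
have c0 : 0 <= 2 ^+ k.+1 * k.+1`!%:R * E.
  by rewrite !mulr_ge0 ?exprn_ge0 ?(ltW fk) // (le_trans _ E1).
have [x1|/ltW x1] := leP `|x| 1.
  have := exprn_ile1 k (normr_ge0 x) x1; lra.
have : `|x| ^+ k <= `|x| ^+ (2 * k.+1).
  by apply: ler_weXn2l => //; lia.
lra.
Qed.

Lemma schwartz_gaussian (R : realType) : schwartz (@gaussian R).
Proof.
split=> [n x|k n]; have [p ->] := derive1n_gaussian R n.
  rewrite -[X in derivable X x 1]/(horner p * @gaussian R).
  have dgx := is_derive_gaussian _ x; exact: ex_derive.
(* The exponent [k] is generalized because the factor ['X] is absorbed into the monomial, so the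
   induction hypothesis is used at [k.+1]. *)
elim/poly_ind: p k => [|p c IHp] k.
  by exists 0 => x; rewrite horner0 mul0r mulr0 normr0.
have [C hC] := IHp k.+1.
have [D hD] := gaussian_monomial_bounded R k.
exists (C + `|c| * D) => x.
have -> : x ^+ k * ((p * 'X + c%:P).[x] * gaussian x) =
    x ^+ k.+1 * (p.[x] * gaussian x) + c * (x ^+ k * gaussian x).
  by rewrite hornerMXaddC exprS; ring.
apply: le_trans (ler_normD _ _) _; rewrite lerD // normrM ler_wpM2l //.
Qed.

(** * Measurability and complex limits *)

Lemma measurable_fun_caratheodory (R : realType) (h : R -> R) :
  continuous h ->
  measurable_fun [set: caratheodory_type (wlength (@idfun R))^*%mu] h.
Proof.
move=> /continuous_measurable_fun mh _ Y mY.
(* Preimages under a continuous map are Borel, hence Caratheodory measurable. *)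
apply: sub_caratheodory; exact: mh measurableT Y mY.
Qed.

Lemma cvg_complex (R : realType) (T : Type) (F : set_system T)
    (FF : Filter F) (a b : T -> R) (l m : R) :
  a x @[x --> F] --> l -> b x @[x --> F] --> m ->
  ((a x +i* b x : R[i]^o) @[x --> F] --> (l +i* m : R[i]^o)).
Proof.
move=> al bm; apply/cvgrPdist_lt => e e0.
(* In the partial order of [R[i]], a positive element is a positive real. *)
have [r r0 ->] : exists2 r : R, 0 < r & e = r%:C.
  case: e e0 => r s; rewrite ltcE /= => /andP[/eqP -> r0].
  by exists r.
(* With both components within r/2, the squared modulus is below r^2/2 < r^2. *)
have r2 : 0 < r / 2 by rewrite divr_gt0.
move/cvgrPdist_lt/(_ _ r2): al => al; move/cvgrPdist_lt/(_ _ r2): bm => bm.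
near=> x.
rewrite normc_def ltcR /= -(gtr0_norm r0) -sqrtr_sqr ltr_sqrt ?exprn_gt0 //.
rewrite -(real_normK (num_real (l - a x))) -(real_normK (num_real (m - b x))).
have lax : `|l - a x| < r / 2 by near: x.
have mbx : `|m - b x| < r / 2 by near: x.
have := normr_ge0 (l - a x); have := normr_ge0 (m - b x).
nra.
Unshelve. all: by end_near. Qed.

Lemma continuous_dilate (R : realType) (rho : R -> R) (e : R) :
  continuous rho -> continuous (dilate rho e).
Proof.
move=> crho x; apply: continuous_comp; last exact: crho.
exact: mulrl_continuous.
Qed.

(** * Dominated convergence for real integrands *)

Section RealDominated.
Variable R : realType.
Local Notation mu := (@completed_lebesgue_measure R).
Local Notation Rc := (caratheodory_type (wlength (@idfun R))^*%mu).

(** Domination by [g]. It serves both for the damping factor [dilate rho eps] and for the cosine and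
    sine of the characteristic function. *)
Lemma integrable_mul_le1 (g h : R -> R) :
  mu.-integrable setT (EFin \o g) -> measurable_fun [set: Rc] h ->
  (forall x, `|h x| <= 1) ->
  mu.-integrable setT (EFin \o (fun x => g x * h x)).
Proof.
move=> ig mh h1; have mg := measurable_int _ ig.
apply: (le_integrable measurableT _ _ ig) => [|x _].
  apply/measurable_EFinP; apply: measurable_funM => //.
  exact/measurable_EFinP.
by rewrite /= lee_fin normrM ler_piMr.
Qed.

Lemma cvg_Rintegral_dilate (g rho : R -> R) :
  mu.-integrable setT (EFin \o g) -> continuous rho ->
  (forall x, 0 <= rho x <= 1) -> rho 0 = 1 ->
  \int[mu]_x (g x * dilate rho eps x) @[eps --> (0 : R)^'+] -->
  \int[mu]_x g x.
Proof.
(* Dominated convergence is about sequences, so the one-sided limit is tested along sequences [u] of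
   positive reals tending to 0. *)
move=> ig crho rho01 rho0; apply/cvg_at_rightP => u [u0 ucvg].
have rho1 x : `|rho x| <= 1.
  by have /andP[r0 r1] := rho01 x; rewrite ger0_norm.
have mdil e : measurable_fun [set: Rc] (dilate rho e).
  exact/measurable_fun_caratheodory/continuous_dilate.
have idil e := integrable_mul_le1 _ _ ig (mdil e) (fun x => rho1 (e * x)).
have ptw : {ae mu, forall x, setT x ->
    (g x * dilate rho (u n) x)%:E @[n --> \oo] --> (g x)%:E}.
  apply: aeW => x _; apply: cvg_EFin; first exact: nearW.
  (* The limit is read as [g x * rho 0], leaving continuity of [rho] at 0. *)
  rewrite -[X in _ --> X]mulr1 -rho0; apply: cvgMr.
  apply: (cvg_comp (fun n => u n * x) rho); last exact: crho.
  by rewrite -(mul0r x); apply: cvgMl.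
have dom : {ae mu, forall x, forall n, setT x ->
    (`|(g x * dilate rho (u n) x)%:E| <= `|(g x)%:E|)%E}.
  by apply: aeW => x n _; rewrite /= lee_fin normrM ler_piMr ?rho1.
have [_ _ dct] := dominated_convergence measurableT
  (fun n => measurable_int _ (idil (u n))) (measurable_int _ ig)
  ptw (integrable_abse ig) dom.
(* The real integral is [fine] of the extended one, and the limit is finite because [g] is
   integrable. *)
apply: fine_cvg; rewrite fineK //.
exact: (integrable_fin_num measurableT ig).
Qed.
End RealDominated.

(** * Complex integrands, reduced to their components *)

Lemma re_part_mul_real (R : realType) (g : R -> R[i]) (h : R -> R) :
  re_part (fun x => g x * (h x)%:C) = fun x => re_part g x * h x.
Proof.
by apply/funext => x; rewrite /re_part; case: (g x) => a b /=; rewrite mulr0 subr0.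
Qed.

Lemma im_part_mul_real (R : realType) (g : R -> R[i]) (h : R -> R) :
  im_part (fun x => g x * (h x)%:C) = fun x => im_part g x * h x.
Proof.
by apply/funext => x; rewrite /im_part; case: (g x) => a b /=; rewrite mulr0 add0r.
Qed.

Lemma weak_expectationE (R : realType) (f psi : R -> R[i]) (phi : R -> R) :
  weak_expectation f phi psi = cintegral (fun x => psi x * f x * (phi x)%:C).
Proof.
by congr cintegral; apply/funext => x; rewrite [f x * _]mulrC.
Qed.

Lemma cvg_weak_expectation_dilate (R : realType) (f psi : R -> R[i])
    (rho : R -> R) :
  integrable_cfun (fun x => psi x * f x) -> continuous rho ->
  (forall x, 0 <= rho x <= 1) -> rho 0 = 1 ->
  (weak_expectation f (dilate rho eps) psi : R[i]^o) @[eps --> (0 : R)^'+] -->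
  (cintegral (fun x => psi x * f x) : R[i]^o).
Proof.
move=> [ire iim] crho rho01 rho0.
under eq_fun do
  rewrite weak_expectationE /cintegral re_part_mul_real im_part_mul_real.
by apply: cvg_complex; exact: cvg_Rintegral_dilate.
Qed.

(** Each component of the product combines the components of [f] with coefficients cos(tx) and
    sin(tx), bounded by 1; hence the characteristic function exists for every [t]. *)
Lemma integrable_cexp_char (R : realType) (f : R -> R[i]) (t : R) :
  integrable_cfun f -> integrable_cfun (fun x => cexp_char t x * f x).
Proof.
move=> [ire iim].
have mcos : measurable_fun [set: caratheodory_type (wlength (@idfun R))^*%mu]
    (dilate (@cos R) t).
  exact/measurable_fun_caratheodory/continuous_dilate/continuous_cos.
have msin : measurable_fun [set: caratheodory_type (wlength (@idfun R))^*%mu]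
    (dilate (@sin R) t).
  exact/measurable_fun_caratheodory/continuous_dilate/continuous_sin.
have cos1 x : `|cos (t * x)| <= 1 by rewrite ler_norml cos_geN1 cos_le1.
have sin1 x : `|sin (t * x)| <= 1 by rewrite ler_norml sin_geN1 sin_le1.
split.
  have -> : EFin \o re_part (fun x => cexp_char t x * f x) =
      ((EFin \o (fun x => (re_part f x * dilate cos t x)%R))
       \- (EFin \o (fun x => (im_part f x * dilate sin t x)%R)))%E.
    apply/funext => x; rewrite /re_part /im_part /dilate /= -EFinB.
    by case: (f x) => a b /=; rewrite mulrC [b * _]mulrC.
  by apply: integrableB => //; exact: integrable_mul_le1.
have -> : EFin \o im_part (fun x => cexp_char t x * f x) =
    ((EFin \o (fun x => (im_part f x * dilate cos t x)%R))
     \+ (EFin \o (fun x => (re_part f x * dilate sin t x)%R)))%E.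
  apply/funext => x; rewrite /re_part /im_part /dilate /= -EFinD.
  by case: (f x) => a b /=; rewrite mulrC [a * _]mulrC.
by apply: integrableD => //; exact: integrable_mul_le1.
Qed.

(** A [rho] with values in [0, 1] may vanish somewhere, so strict positivity of the dilates is
    asserted for strictly positive [rho], such as the Gaussian. *)
Theorem lemma2p10 (R : realType) (f : R -> R[i]) (rho : R -> R)
    (hf : integrable_cfun f)
    (hrho : schwartz rho)
    (hrho01 : forall x : R, 0 <= rho x <= 1)
    (hrho0 : rho 0 = 1) :
  [/\ (* the Gaussian is an admissible (strictly positive) choice of rho *)
      [/\ schwartz (@gaussian R),
          (forall x : R, 0 < gaussian x <= 1) &
          gaussian (0 : R) = 1],
      (* properties of phi_eps = dilate rho eps *)
      [/\ (forall eps : R, 0 < eps -> schwartz (dilate rho eps)),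
          (forall eps x : R, 0 < eps -> 0 <= dilate rho eps x),
          ((forall x : R, 0 < rho x) ->
             forall eps x : R, 0 < eps -> 0 < dilate rho eps x) &
          (forall x : R, dilate rho eps x @[eps --> (0 : R)^'+] --> (1 : R))],
      (* convergence of the weak expectations *)
      (forall psi : R -> R[i],
         measurable_cfun psi -> integrable_cfun (fun x => psi x * f x) ->
         [/\ (forall eps : R, 0 < eps ->
                integrable_cfun
                  (fun x => psi x * (dilate rho eps x)%:C * f x)),
             (forall eps : R, 0 < eps ->
                weak_expectation f (dilate rho eps) psi =
                cintegral (fun x => psi x * (dilate rho eps x)%:C * f x)) &
             ((weak_expectation f (dilate rho eps) psi : R[i]^o)
                @[eps --> (0 : R)^'+] -->
              (cintegral (fun x => psi x * f x) : R[i]^o))]),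
      (* moments *)
      (forall n : nat,
         integrable_cfun (fun x => cmonomial n x * f x) ->
         ((weak_expectation f (dilate rho eps) (cmonomial n) : R[i]^o)
            @[eps --> (0 : R)^'+] -->
          (cintegral (fun x => cmonomial n x * f x) : R[i]^o))) &
      (* characteristic function *)
      (forall t : R,
         integrable_cfun (fun x => cexp_char t x * f x) /\
         ((weak_expectation f (dilate rho eps) (cexp_char t) : R[i]^o)
            @[eps --> (0 : R)^'+] -->
          (cintegral (fun x => cexp_char t x * f x) : R[i]^o)))].
Proof.
(* Order 0 of the smoothness clause makes [rho] itself differentiable. *)
have crho : continuous rho.
  move=> x; apply/differentiable_continuous/derivable1_diffP.
  exact: hrho.1 0%N x.
have mdil e : measurable_fun [set: caratheodory_type (wlength (@idfun R))^*%mu]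
    (dilate rho e).
  exact/measurable_fun_caratheodory/continuous_dilate.
split.
- split; first exact: schwartz_gaussian.
    by move=> x; rewrite expR_gt0 expR_le1 mulNr oppr_le0 divr_ge0 ?sqr_ge0.
  by rewrite /gaussian expr0n oppr0 mul0r expR0.
- split=> [e e0|e x _|rho_gt0 e x _|x].
  + exact: schwartz_dilate.
  + by have /andP[] := hrho01 (e * x).
  + exact: rho_gt0.
  + apply: cvg_at_right_filter.
    have := cvg_comp _ _ (@mulrr_continuous _ x 0) (crho (0 * x)).
    by rewrite mul0r hrho0.
- move=> psi mpsi ipsi.
  have phiE e : (fun x => psi x * (dilate rho e x)%:C * f x) =
      (fun x => psi x * f x * (dilate rho e x)%:C).
    by apply/funext => x; rewrite mulrAC.
  split=> [e e0|e e0|].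
  + rewrite phiE; have [ire iim] := ipsi.
    have rho1 x : `|dilate rho e x| <= 1.
      by have /andP[r0 r1] := hrho01 (e * x); rewrite ger0_norm.
    split; rewrite ?re_part_mul_real ?im_part_mul_real;
      exact: integrable_mul_le1.
  + by rewrite weak_expectationE phiE.
  + exact: cvg_weak_expectation_dilate.
- by move=> n ipsi; exact: cvg_weak_expectation_dilate.
- move=> t; have ipsi := integrable_cexp_char _ _ t hf.
  by split => //; exact: cvg_weak_expectation_dilate.
Qed.
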